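(* Let $\gamma:I\to(M^m,g)$ be a regular curve parametrized by arc length in a Riemannian manifold $(M^m,g)$, where $I\subseteq\mathbb{R}$ is an open interval. Then $\gamma$ is an $H$-tensional curve if and only if it is a geodesic.
   Context: The interval $I$ carries its standard metric $ds^2$. Let $\nabla_{\gamma'}$ denote covariant differentiation along $\gamma$ induced by the Levi-Civita connection of $(M,g)$, with $\gamma'=\frac{d\gamma}{ds}$. The tension field of $\gamma$ is $\tau(\gamma)=\nabla_{\gamma'}\gamma'$, and the rough Laplacian on vector fields $\xi$ along $\gamma$ is $\Delta^\gamma\xi=-\nabla_{\gamma'}\nabla_{\gamma'}\xi$. The curve $\gamma$ is called $H$-tensional if $\Delta^\gamma\tau(\gamma)=0$, i.e. $\nabla_{\gamma'}\nabla_{\gamma'}\nabla_{\gamma'}\gamma'=0$. It is a geodesic if $\nabla_{\gamma'}\gamma'=0$. *)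

(* Defs.v *)
From HB Require Import structures.
From mathcomp Require Import all_boot all_order all_algebra.
From mathcomp Require Import all_classical all_reals all_analysis.
From mathcomp Require Import ring.
Set Implicit Arguments.
Unset Strict Implicit.
Unset Printing Implicit Defensive.
Import Order.TTheory GRing.Theory Num.Theory.
Import numFieldNormedType.Exports.
Local Open Scope classical_set_scope.
Local Open Scope ring_scope.

Notation "'e_ i" := (delta_mx 0 i) (at level 8, i at level 2, format "''e_' i").

Section Smooth.
Context {R : realType} {m : nat} {V : normedModType R}.

(* Meant for open [U]; ['D_('e_i) f] is then the i-th partial derivative. *)
Fixpoint Ck_on (k : nat) (U : set 'rV[R]_m) (f : 'rV[R]_m -> V) : Prop :=
  (forall x, U x -> {for x, continuous f}) /\
  (if k is k'.+1 then
     forall i : 'I_m, (forall x, U x -> derivable f x 'e_i) /\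
                      Ck_on k' U (fun x => 'D_('e_i) f x)
   else True).

Definition smooth_on (U : set 'rV[R]_m) (f : 'rV[R]_m -> V) : Prop :=
  forall k, Ck_on k U f.

End Smooth.

(* [chart_map] and [chart_inv] are total functions; they are meaningful only on
   [chart_dom] and on its image [chart_img] respectively. *)
Record chart (R : realType) (m : nat) (M : topologicalType) := Chart {
  chart_dom : set M;
  chart_map :> M -> 'rV[R]_m;
  chart_inv : 'rV[R]_m -> M;
  chart_img := chart_map @` chart_dom;
  open_chart_dom : open chart_dom;
  open_chart_img : open chart_img;
  chart_mapK : forall p, chart_dom p -> chart_inv (chart_map p) = p;
  chart_map_continuous : forall p, chart_dom p -> {for p, continuous chart_map};
  chart_inv_continuous : forall x, chart_img x -> {for x, continuous chart_inv}
}.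

Section Transition.
Context {R : realType} {m : nat} {M : topologicalType}.

Definition transition (c d : chart R m M) : 'rV[R]_m -> 'rV[R]_m :=
  d \o chart_inv c.

Definition overlap (c d : chart R m M) : set 'rV[R]_m :=
  c @` (chart_dom c `&` chart_dom d).

End Transition.

Record smooth_manifold (R : realType) (m : nat) := SmoothManifold {
  manifold_space :> topologicalType;
  manifold_hausdorff : hausdorff_space manifold_space;
  manifold_second_countable : @second_countable manifold_space;
  atlas : set (chart R m manifold_space);
  atlas_cover : forall p, exists2 c, atlas c & chart_dom c p;
  atlas_smooth : forall c d, atlas c -> atlas d ->
    smooth_on (overlap c d) (transition c d)
}.

(* A metric is the family of its Gram matrices in the charts of the atlas.
   Tangent vectors are row vectors, so [u] in the chart [c] becomes
   [u *m 'J (transition c d) x] in the chart [d]. *)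
Record riemannian_metric (R : realType) (m : nat) (M : smooth_manifold R m) :=
  RiemannianMetric {
  gram :> chart R m M -> 'rV[R]_m -> 'M[R]_m;
  gram_smooth : forall c, atlas c -> smooth_on (chart_img c) (gram c);
  gram_sym : forall c x, atlas c -> chart_img c x -> (gram c x)^T = gram c x;
  gram_pos : forall c x, atlas c -> chart_img c x ->
    forall u : 'rV[R]_m, u != 0 -> 0 < (u *m gram c x *m u^T) 0 0;
  gram_transition : forall c d x, atlas c -> atlas d -> overlap c d x ->
    gram c x = 'J (transition c d) x *m gram d (transition c d x)
                 *m ('J (transition c d) x)^T
}.

Section LeviCivita.
Context {R : realType} {m : nat} {M : smooth_manifold R m}.
Variable g : riemannian_metric M.

Definition ginner (c : chart R m M) (x u v : 'rV[R]_m) : R :=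
  (u *m g c x *m v^T) 0 0.

Definition gnorm (c : chart R m M) (x u : 'rV[R]_m) : R :=
  Num.sqrt (ginner c x u u).

Definition dgram (c : chart R m M) (x : 'rV[R]_m) (l i j : 'I_m) : R :=
  'D_('e_l) (g c) x i j.

(* [christoffel c x k i j] is the coefficient of the k-th coordinate field in
   the covariant derivative of the j-th one along the i-th one. *)
Definition christoffel (c : chart R m M) (x : 'rV[R]_m) (k i j : 'I_m) : R :=
  2^-1 * \sum_l invmx (g c x) k l *
           (dgram c x i j l + dgram c x j i l - dgram c x l i j).

Definition torsion_free (G : 'I_m -> 'I_m -> 'I_m -> R) : Prop :=
  forall k i j, G k i j = G k j i.

Definition metric_compatible (c : chart R m M) (x : 'rV[R]_m)
    (G : 'I_m -> 'I_m -> 'I_m -> R) : Prop :=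
  forall l i j, dgram c x l i j =
    \sum_k G k l i * g c x k j + \sum_k G k l j * g c x i k.

Lemma gram_unitmx c x : atlas c -> chart_img c x -> g c x \in unitmx.
Proof.
move=> hc hx; rewrite -row_free_unit -kermx_eq0; apply/eqP/row_matrixP => i.
rewrite row0; apply/eqP; apply: contraT => u0.
have := gram_pos g hc hx u0.
by rewrite -row_mul mulmx_ker row0 mul0mx mxE ltxx.
Qed.

Lemma derivable_gram c x l : atlas c -> chart_img c x -> derivable (g c) x 'e_l.
Proof. by move=> hc hx; have [_ /(_ l)[+ _]] := gram_smooth g hc 1; exact. Qed.

Lemma dgram_sym c x l i j : atlas c -> chart_img c x ->
  dgram c x l i j = dgram c x l j i.
Proof.
move=> hc hx; have D := @derivable_gram c x l hc hx.
rewrite /dgram derive_mx// !mxE; apply: near_eq_derive.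
near=> y; rewrite -[in LHS](gram_sym g hc) ?mxE//.
by near: y; apply: open_nbhs_nbhs; split=> //; exact: open_chart_img.
Unshelve. all: by end_near. Qed.

(* The Christoffel symbols are the coefficients of the unique torsion-free
   connection compatible with the metric. *)
Lemma levi_civitaP c x (G : 'I_m -> 'I_m -> 'I_m -> R) :
  atlas c -> chart_img c x ->
  (torsion_free G /\ metric_compatible c x G) <->
  (forall k i j, G k i j = christoffel c x k i j).
Proof.
move=> hc hx; have gU := gram_unitmx hc hx.
have gS i j : g c x i j = g c x j i.
  by rewrite -[in LHS](gram_sym g hc hx) mxE.
pose low l i j := \sum_k g c x l k * G k i j.
pose K l i j := 2^-1 * (dgram c x i j l + dgram c x j i l - dgram c x l i j).
have chrE k i j : christoffel c x k i j = \sum_l invmx (g c x) k l * K l i j.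
  by rewrite /christoffel mulr_sumr; apply: eq_bigr => l _; rewrite mulrCA.
have lowE k i j : G k i j = \sum_l invmx (g c x) k l * low l i j.
  pose v : 'cV[R]_m := \col_k G k i j.
  have := congr1 (fun w : 'cV[R]_m => w k 0) (mulKmx gU v).
  rewrite !mxE => <-; apply: eq_bigr => l _; rewrite mxE; congr (_ * _).
  by apply: eq_bigr => k' _; rewrite mxE.
have compE l i j : \sum_k G k l i * g c x k j + \sum_k G k l j * g c x i k =
    low j l i + low i l j.
  by congr (_ + _); apply: eq_bigr => k _; rewrite mulrC// gS.
split=> [[tf mc] k i j|GE].
- rewrite chrE lowE; apply: eq_bigr => l _; congr (_ * _).
  have low_sym a b d : low a b d = low a d b.
    by apply: eq_bigr => k' _; rewrite tf.
  rewrite /K !mc !compE (low_sym l j i) (low_sym i l j) (low_sym j l i).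
  by field.
- have low_chr l i j : low l i j = K l i j.
    pose v : 'cV[R]_m := \col_l K l i j.
    have := congr1 (fun w : 'cV[R]_m => w l 0) (mulKVmx gU v).
    rewrite !mxE => <-; apply: eq_bigr => k _; rewrite mxE; congr (_ * _).
    by rewrite GE chrE; apply: eq_bigr => l' _; rewrite mxE.
  split=> [k i j|l i j].
  + rewrite !GE !chrE; apply: eq_bigr => l _; congr (_ * (_ * _)).
    by rewrite (dgram_sym l i j hc hx) [X in X - _]addrC.
  + rewrite compE !low_chr /K (dgram_sym i l j hc hx) (dgram_sym j l i hc hx).
    by rewrite (dgram_sym l j i hc hx); field.
Qed.

End LeviCivita.

Section Curves.
Context {R : realType} {m : nat} {M : smooth_manifold R m}.
Variable g : riemannian_metric M.
Variables (I : set R) (gamma : R -> M).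

(* A vector field along [gamma] is given by its components in every chart;
   only the values at [c] in the atlas and [s] in [I] with [gamma s] in the
   domain of [c] are meaningful. *)
Definition field_along := chart R m M -> R -> 'rV[R]_m.

Definition smooth_curve : Prop :=
  (forall s, I s -> {for s, continuous gamma}) /\
  (forall c s, atlas c -> I s -> chart_dom c (gamma s) ->
     forall n, derivable (derive1n n (c \o gamma)) s 1).

Definition velocity : field_along := fun c => derive1 (c \o gamma).

Definition regular_curve : Prop := smooth_curve /\
  forall c s, atlas c -> I s -> chart_dom c (gamma s) -> velocity c s != 0.

Definition unit_speed : Prop :=
  forall c s, atlas c -> I s -> chart_dom c (gamma s) ->
    gnorm g c (c (gamma s)) (velocity c s) = 1.

Definition cov_deriv (xi : field_along) : field_along := fun c s =>
  derive1 (xi c) s +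
  \row_k \sum_i \sum_j
    christoffel g c (c (gamma s)) k i j * velocity c s 0 i * xi c s 0 j.

Definition vanishes_along (xi : field_along) : Prop :=
  forall c s, atlas c -> I s -> chart_dom c (gamma s) -> xi c s = 0.

Definition tension_field : field_along := cov_deriv velocity.

Definition rough_laplacian (xi : field_along) : field_along :=
  fun c s => - cov_deriv (cov_deriv xi) c s.

Definition H_tensional : Prop := vanishes_along (rough_laplacian tension_field).

Definition geodesic : Prop := vanishes_along tension_field.

End Curves.

(* Main.v *)
Require Import Defs.
From HB Require Import structures.
From mathcomp Require Import all_boot all_order all_algebra.
From mathcomp Require Import all_classical all_reals all_analysis.
Set Implicit Arguments.
Unset Strict Implicit.
Unset Printing Implicit Defensive.
Import Order.TTheory GRing.Theory Num.Theory.
Import numFieldNormedType.Exports.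
Local Open Scope classical_set_scope.
Local Open Scope ring_scope.

(** Write [T0] for the velocity of [gamma] and [T1], [T2], [T3] for its
    successive covariant derivatives along [gamma]; being H-tensional means
    [T3 = 0] and being a geodesic means [T1 = 0].  If [T1 = 0] then
    differentiating gives [T3 = 0].  Conversely, differentiate [<T0, T0> = 1]
    repeatedly with the Leibniz rule of the Levi-Civita connection:
    - [<T1, T0> = 0];
    - [<T2, T0> + <T1, T1> = 0];
    - [<T3, T0> + 3 <T2, T1> = 0], so [<T2, T1> = 0] as [T3 = 0];
    - [<T3, T1> + <T2, T2> = 0], so [T2 = 0] as the metric is definite;
    and the second line then gives [<T1, T1> = 0], that is [T1 = 0].  No step
    integrates an equation, so everything happens at the times [gamma] spends
    in one chart, which form an open set (H_tensional_geodesic).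

    The work lies in justifying the differentiations in coordinates.  The
    Leibniz rule (is_derive_ginner) amounts to [G' = C G + G C^T] for the Gram
    matrix [G] along the curve, where [C] contracts the Christoffel symbols with
    the velocity (is_derive_gram).  This combines metric compatibility with the
    chain rule for a function of several variables with continuous partial
    derivatives (chain_rule), itself a consequence of the mean value inequality
    (Ck1_differentiable).  Moreover [T1] and [T2] must have differentiable
    components: the Christoffel symbols involve the inverse of the Gram matrix,
    so the class of [n] times derivable functions on an open set of times is
    shown to be closed under ring operations, inverses, matrix inversion, and
    composition with functions of class [C^n] (nderivable_comp). *)

(** * Differentiability from continuous partial derivatives *)

(** The interval runs from [0] to [a] for either sign of [a]: below, [a] is a
    coordinate of an arbitrary displacement. *)
Lemma mean_value_le (R : realType) (h dh : R -> R) (a e : R) :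
  (forall t : R, `|t| <= `|a| -> is_derive t (1 : R) h (dh t)) ->
  (forall t, `|t| <= `|a| -> `|dh t| <= e) ->
  `|h a - h 0| <= e * `|a|.
Proof.
move=> hD hB.
wlog a0 : h dh a hD hB / 0 <= a.
  move=> W; have [a0|a0] := leP 0 a; first exact: (W h dh).
  have hD' (t : R) : `|t| <= `|- a| ->
      is_derive t (1 : R) (h \o -%R) (- dh (- t)).
    rewrite normrN => ta; rewrite -mulrN1.
    by apply: is_derive1_comp; apply: hD; rewrite normrN.
  have := W (h \o -%R) (fun t => - dh (- t)) (- a) hD'.
  rewrite /= opprK oppr0 normrN; apply; last by rewrite oppr_ge0 ltW.
  by move=> t ta; rewrite normrN hB// normrN.
have in_a t : t \in `[0, a] -> `|t| <= `|a|.
  by rewrite in_itv/= => /andP[t0 ta]; rewrite !ger0_norm.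
have hD0 t : t \in `]0, a[ -> is_derive t 1 h (dh t).
  by move=> /subset_itv_oo_cc/in_a; exact: hD.
have hc : {within `[0, a], continuous h}.
  by apply: derivable_within_continuous => t /in_a/hD[].
have [c /in_a ca ->] := MVT_segment a0 hD0 hc.
by rewrite normrM subr0 ler_wpM2r// hB.
Qed.

Lemma is_derive_line (R : realType) (V W : normedModType R) (f : V -> W)
    (y v : V) (t : R) :
  derivable f (y + t *: v) v ->
  is_derive t 1 (fun u => f (y + u *: v)) ('D_v f (y + t *: v)).
Proof.
have E : (fun h : R => h^-1 *:
      (((fun u => f (y + u *: v)) \o shift t) (h *: 1) - f (y + t *: v))) =
    (fun h => h^-1 *: ((f \o shift (y + t *: v)) (h *: v) - f (y + t *: v))).
  apply/funext => h /=; congr (_ *: (f _ - _)).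
  by rewrite [h *: 1]mulr1 scalerDl addrCA.
move=> df; apply: DeriveDef; first by rewrite /derivable E.
by rewrite /derive E.
Qed.

Lemma norm_row_le (R : realType) m (v : 'rV[R]_m) (d : R) :
  0 <= d -> (forall i, `|v 0 i| <= d) -> `|v| <= d.
Proof.
move=> d0 H; rewrite [leLHS]/Num.Def.normr/= mx_normrE (bigmax_le _ d0)//=.
by move=> -[i j] _ /=; rewrite ord1.
Qed.

Lemma norm_row_ge (R : realType) m (v : 'rV[R]_m) i : `|v 0 i| <= `|v|.
Proof.
by rewrite [leRHS]/Num.Def.normr/= mx_normrE; exact: (le_bigmax _ _ (0, i)).
Qed.

(** Replaces the little-o in the definition of differentiability by explicit
    estimates, for a candidate differential [L]. *)
Lemma differentiable_of_approx (R : realType) (V W : normedModType R)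
    (f : V -> W) (L : {linear V -> W}) p :
  continuous L ->
  (forall e, 0 < e ->
     \forall v \near 0, `|f (v + p) - (f p + L v)| <= e * `|v|) ->
  differentiable f p.
Proof.
move=> Lc fL.
have key : f \o shift p = cst (f p) + L +o_ 0 id by exact/eqaddoP.
by apply/diff_locallyP; rewrite (diff_unique Lc key).
Qed.

(** Move from [p] to [p + v] one coordinate at a time.  Each move is parallel to
    an axis, so the mean value inequality compares it with the partial derivative
    at [p], up to the oscillation of that partial derivative near [p]. *)
Lemma Ck1_differentiable (R : realType) m (U : set 'rV[R]_m)
    (f : 'rV[R]_m -> R) p :
  open U -> Ck_on 1 U f -> U p -> differentiable f p.
Proof.
move=> oU [_ fC] Up.
pose a i := 'D_('e_i) f p.
pose L (v : 'rV[R]_m) := \sum_i v 0 i * a i.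
have L_lin : linear (L : 'rV[R]_m -> R).
  move=> k u v; rewrite /L scaler_sumr -big_split/=.
  by apply: eq_bigr => i _; rewrite !mxE mulrDl -mulrA.
pose LM := GRing.isLinear.Build _ _ _ _ _ L_lin.
pose LL : {linear 'rV[R]_m -> R} := HB.pack L LM.
have LLc : continuous LL.
  have coord_cvg (i : 'I_m) (v : 'rV[R]_m) :
      (w 0 i * a i) @[w --> v] --> (v 0 i * a i : R).
    by apply: cvgM; [exact: coord_continuous|exact: cvg_cst].
  by apply: continuous_big => [|i _]; [exact: add_continuous|exact: coord_cvg].
apply: (differentiable_of_approx LLc) => e e0.
(* Each of the m coordinate moves may cost e / (m + 1) times the norm of v; the
   successor covers dimension 0. *)
have m0 : 0 < m.+1%:R :> R by rewrite ltr0n.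
have e1 : 0 < e / m.+1%:R by rewrite divr_gt0.
have : \forall y \near p,
    U y /\ forall i, `|'D_('e_i) f y - a i| <= e / m.+1%:R.
  near=> y; split; first by near: y; exact: open_nbhs_nbhs.
  near: y; apply: filter_forall => i.
  have [_ [+ _]] := fC i.
  move=> /(_ p Up) /cvgrPdist_le /(_ _ e1).
  by apply: filterS => y; rewrite distrC.
move=> /nbhs_ballP[d /= d0 dB].
have small_v : \forall v \near (0 : 'rV[R]_m), `|v| < d by exact: nbhs0_lt.
near=> v.
have vd : `|v| < d by near: v.
(* [y k] has already moved in its first [k] coordinates. *)
pose y (k : nat) : 'rV[R]_m :=
  \row_j (p 0 j + (if (j < k)%N then v 0 j else 0)).
have y0 : y 0%N = p by apply/rowP => j; rewrite mxE addr0.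
have ym : y m = v + p by apply/rowP => j; rewrite !mxE ltn_ord addrC.
have yS (i : 'I_m) : y i.+1 = y i + v 0 i *: 'e_i.
  apply/rowP => j; rewrite !mxE eqxx/= -addrA ltnS leq_eqVlt; congr (_ + _).
  have [/val_inj->|ne] := eqVneq (val j) (val i).
    by rewrite eqxx ltnn add0r mulr1.
  have /negbTE-> : j != i by apply: contra_neq ne => ->.
  by rewrite mulr0 addr0.
have -> : f (v + p) - (f p + LL v) =
    \sum_(i < m) (f (y i.+1) - f (y i) - v 0 i * a i).
  rewrite sumrB -(big_mkord predT (fun i => f (y i.+1) - f (y i))).
  by rewrite telescope_sumr// y0 ym opprD addrA.
have step (i : 'I_m) :
    `|f (y i.+1) - f (y i) - v 0 i * a i| <= e / m.+1%:R * `|v|.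
  pose h t := f (y i + t *: 'e_i) - t * a i.
  have yB t : `|t| <= `|v 0 i| -> ball p d (y i + t *: 'e_i).
    move=> tv; rewrite -ball_normE/= (le_lt_trans _ vd)// norm_row_le// => j.
    rewrite !mxE eqxx/= -addrA opprD addrA subrr add0r normrN.
    have [->|ne] := eqVneq j i.
      by rewrite ltnn add0r mulr1 (le_trans tv)// norm_row_ge.
    by rewrite mulr0 addr0; case: ifP; rewrite ?normr0// norm_row_ge.
  have -> : f (y i.+1) - f (y i) - v 0 i * a i = h (v 0 i) - h 0.
    by rewrite /h yS scale0r addr0 mul0r subr0 addrAC.
  apply: (@le_trans _ _ (e / m.+1%:R * `|v 0 i|)); last first.
    by rewrite ler_wpM2l ?norm_row_ge// ltW.
  apply: (@mean_value_le _ h (fun t => 'D_('e_i) f (y i + t *: 'e_i) - a i)).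
    move=> t /yB/dB[Ut _].
    have ? := is_derive_line ((fC i).1 _ Ut).
    have lin : is_derive t (1 : R) (fun u => u * a i) (a i).
      have := is_deriveM (is_derive_id t 1) (is_derive_cst (a i) t 1).
      move=> /is_derive_eq; apply.
      by rewrite scaler0 add0r [LHS]mulr1.
    by rewrite /h; apply: is_deriveB.
  by move=> t /yB/dB[_]; exact.
apply: le_trans (ler_norm_sum _ _ _) _.
apply: le_trans (ler_sum _ (fun i _ => step i)) _.
rewrite sumr_const card_ord -[leLHS]mulr_natl mulrA ler_wpM2r//.
by rewrite mulrCA ger_pMr// ler_pdivrMr// mul1r ler_nat.
Unshelve. all: by end_near. Qed.

Lemma chain_rule (R : realType) m (U : set 'rV[R]_m)
    (f : 'rV[R]_m -> R) (x : R -> 'rV[R]_m) s :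
  open U -> Ck_on 1 U f -> U (x s) -> derivable x s 1 ->
  is_derive s 1 (f \o x) (\sum_i 'D_('e_i) f (x s) * derive1 x s 0 i).
Proof.
move=> oU fC Us dx.
have df := Ck1_differentiable oU fC Us.
have dx' : differentiable x s by apply/derivable1_diffP.
have dfx : differentiable (f \o x) s by exact: differentiable_comp.
apply: DeriveDef; first exact/derivable1_diffP.
rewrite deriveE// diff_comp//= -(deriveE _ dx') -derive1E.
rewrite [in LHS](row_sum_delta (derive1 x s)) linear_sum; apply: eq_bigr => i _.
by rewrite linearZ/= -deriveE// mulrC.
Qed.

(** * Functions of class C^k on an open set *)

Lemma open_near_eq (T : topologicalType) (W : Type) (U : set T)
    (f g : T -> W) x :
  open U -> U x -> (forall y, U y -> f y = g y) -> \forall y \near x, f y = g y.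
Proof.
by move=> oU Ux fg; apply: filterS (open_nbhs_nbhs (conj oU Ux)).
Qed.

Lemma for_continuous_ext (T V : topologicalType) (U : set T) (f h : T -> V) x :
  open U -> (forall y, U y -> f y = h y) -> U x ->
  {for x, continuous f} -> {for x, continuous h}.
Proof.
move=> oU fh Ux fc; have : h @ x --> h x.
  rewrite -(fh x Ux); apply: cvg_trans fc.
  by apply: near_eq_cvg; exact: open_near_eq oU Ux fh.
exact.
Qed.

Lemma Ck_on_ext (R : realType) m (V : normedModType R) k (U : set 'rV[R]_m)
    (f h : 'rV[R]_m -> V) :
  open U -> (forall x, U x -> f x = h x) -> Ck_on k U f -> Ck_on k U h.
Proof.
move=> oU; elim: k f h => [|k IH] f h fh [fc fD].
  by split=> // x Ux; exact: for_continuous_ext oU fh Ux (fc x Ux).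
split=> [x Ux|i]; first exact: for_continuous_ext oU fh Ux (fc x Ux).
have [fd fk] := fD i; split=> [x Ux|].
  by apply: near_eq_derivable (fd x Ux); exact: open_near_eq oU Ux fh.
apply: IH fk => x Ux.
by apply: near_eq_derive; exact: open_near_eq oU Ux fh.
Qed.

Lemma Ck_on_pred (R : realType) m (V : normedModType R) k (U : set 'rV[R]_m)
    (f : 'rV[R]_m -> V) :
  Ck_on k.+1 U f -> Ck_on k U f.
Proof.
elim: k f => [|k IH] f [fc fD]; first by split.
by split=> // i; have [fd fk] := fD i; split=> //; exact: IH.
Qed.

Lemma Ck_on_ge1 (R : realType) m (V : normedModType R) k (U : set 'rV[R]_m)
    (f : 'rV[R]_m -> V) :
  Ck_on k.+1 U f -> Ck_on 1 U f.
Proof. by elim: k => // k IH /Ck_on_pred. Qed.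

Lemma Ck_on_entry (R : realType) m p q k (U : set 'rV[R]_m)
    (G : 'rV[R]_m -> 'M[R]_(p, q)) i j :
  open U -> Ck_on k U G -> Ck_on k U (fun x => G x i j).
Proof.
move=> oU.
have entryc (F : 'rV[R]_m -> 'M[R]_(p, q)) x :
    {for x, continuous F} -> {for x, continuous (fun y => F y i j)}.
  move=> Fc; apply: (@continuous_comp _ _ _ F (fun A => A i j) x Fc).
  exact: coord_continuous.
elim: k G => [|k IH] G [Gc GD]; first by split=> // x /Gc/entryc.
split=> [x /Gc/entryc//|l].
have [Gd Gk] := GD l; split=> [x Ux|].
  by have /derivable_mxP := Gd x Ux; exact.
apply: Ck_on_ext (IH _ Gk) => // x Ux.
by rewrite derive_mx ?mxE//; exact: Gd.
Qed.

(** * Functions that are n times derivable on an open set of times *)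

(** By recursion on the derivative rather than through [derive1n], so that the
    product rule and the chain rule propagate by induction on [n]. *)
Fixpoint nderivable_on (R : realType) (n : nat) (U : set R) (f : R -> R) : Prop :=
  if n is n'.+1 then
    (forall s, U s -> derivable f s 1) /\ nderivable_on n' U (derive1 f)
  else True.

Section nderivable_theory.
Context {R : realType}.
Variable U : set R.
Hypothesis oU : open U.
Implicit Types f h : R -> R.

Lemma eq_derive1_on (V : normedModType R) (f h : R -> V) s :
  U s -> (forall t, U t -> f t = h t) -> derive1 f s = derive1 h s.
Proof.
move=> Us fh; rewrite !derive1E; apply: near_eq_derive.
exact: open_near_eq oU Us fh.
Qed.

Lemma nderivable_ext n f h : (forall s, U s -> f s = h s) ->
  nderivable_on n U f -> nderivable_on n U h.
Proof.
elim: n f h => //= n IH f h fh [fd fn]; split=> [s Us|].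
  by apply: near_eq_derivable (fd s Us); exact: open_near_eq oU Us fh.
by apply: IH fn => s Us; exact: eq_derive1_on.
Qed.

Lemma nderivable_pred n f : nderivable_on n.+1 U f -> nderivable_on n U f.
Proof.
by elim: n f => // n IH f [fd fn]; split=> //; exact: IH.
Qed.

Lemma nderivable_cst n (a : R) : nderivable_on n U (fun=> a).
Proof.
elim: n a => //= n IH a; split=> [s _|]; first exact: derivable_cst.
by apply: nderivable_ext (IH 0) => s _; rewrite derive1_cst.
Qed.

Lemma nderivableD n f h :
  nderivable_on n U f -> nderivable_on n U h ->
  nderivable_on n U (fun s => f s + h s).
Proof.
elim: n f h => //= n IH f h [fd fn] [hd hn]; split=> [s Us|].
  by apply: derivableD; [exact: fd|exact: hd].
apply: nderivable_ext (IH _ _ fn hn) => s Us.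
by rewrite !derive1E deriveD//; [exact: fd|exact: hd].
Qed.

Lemma nderivableM n f h :
  nderivable_on n U f -> nderivable_on n U h ->
  nderivable_on n U (fun s => f s * h s).
Proof.
elim: n f h => // n IH f h Ff Fh.
have [fd fn] := Ff; have [hd hn] := Fh; split=> [s Us|].
  by apply: derivableM; [exact: fd|exact: hd].
have := nderivableD (IH _ _ (nderivable_pred Ff) hn)
  (IH _ _ (nderivable_pred Fh) fn).
apply: nderivable_ext => s Us.
by rewrite !derive1E deriveM//; [exact: fd|exact: hd].
Qed.

(** The derivative [- f' / f^2] is a product of [f'] and of two copies of the
    inverse, to which the induction hypothesis applies. *)
Lemma nderivableV n f : (forall s, U s -> f s != 0) ->
  nderivable_on n U f -> nderivable_on n U (fun s => (f s)^-1).
Proof.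
move=> f0; elim: n => // n IH Ff; have [fd fn] := Ff; split=> [s Us|].
  by apply: derivableV; [exact: f0|exact: fd].
have FV := IH (nderivable_pred Ff).
have := nderivableM (nderivableM (nderivable_cst n (-1)) (nderivableM FV FV)) fn.
apply: nderivable_ext => s Us.
rewrite !derive1E deriveV//; [|exact: f0|exact: fd].
by rewrite mulN1r expr2 invfM.
Qed.

Lemma nderivable_sum n (J : Type) (r : seq J) (P : pred J) (F : J -> R -> R) :
  (forall i, nderivable_on n U (F i)) ->
  nderivable_on n U (fun s => \sum_(i <- r | P i) F i s).
Proof.
move=> HF; elim: r => [|i r IH].
  by apply: nderivable_ext (nderivable_cst n 0) => s _; rewrite big_nil.
case: (boolP (P i)) => Pi.
  by apply: nderivable_ext (nderivableD (HF i) IH) => s _; rewrite big_cons Pi.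
by apply: nderivable_ext IH => s _; rewrite big_cons (negbTE Pi).
Qed.

Lemma nderivable_prod n (J : Type) (r : seq J) (P : pred J) (F : J -> R -> R) :
  (forall i, nderivable_on n U (F i)) ->
  nderivable_on n U (fun s => \prod_(i <- r | P i) F i s).
Proof.
move=> HF; elim: r => [|i r IH].
  by apply: nderivable_ext (nderivable_cst n 1) => s _; rewrite big_nil.
case: (boolP (P i)) => Pi.
  by apply: nderivable_ext (nderivableM (HF i) IH) => s _; rewrite big_cons Pi.
by apply: nderivable_ext IH => s _; rewrite big_cons (negbTE Pi).
Qed.

Definition mx_nderivable n p q (A : R -> 'M[R]_(p, q)) :=
  forall i j, nderivable_on n U (fun s => A s i j).

Lemma nderivable_det n p (A : R -> 'M[R]_p) :
  mx_nderivable n A -> nderivable_on n U (fun s => \det (A s)).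
Proof.
move=> HA; apply: nderivable_sum => w.
by apply: nderivableM; [exact: nderivable_cst|apply: nderivable_prod => i].
Qed.

(** Cramer's formula reduces the entries to determinants. *)
Lemma mx_nderivable_inv n p (A : R -> 'M[R]_p) :
  (forall s, U s -> A s \in unitmx) ->
  mx_nderivable n A -> mx_nderivable n (fun s => invmx (A s)).
Proof.
move=> uA HA i j.
have detV : nderivable_on n U (fun s => (\det (A s))^-1).
  apply: nderivableV; last exact: nderivable_det.
  by move=> s /uA; rewrite unitmxE unitfE.
have cof : nderivable_on n U (fun s => cofactor (A s) j i).
  apply: nderivableM; first exact: nderivable_cst.
  by apply: nderivable_det => a b; under eq_fun do rewrite !mxE.
apply: nderivable_ext (nderivableM detV cof) => s Us.
by rewrite /invmx (uA _ Us) !mxE.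
Qed.

Lemma derive1_mxE p q (A : R -> 'M[R]_(p, q)) s i j :
  derivable A s 1 -> derive1 A s i j = derive1 (fun t => A t i j) s.
Proof. by move=> dA; rewrite !derive1E derive_mx// mxE. Qed.

(** Links the iterated derivatives by which smoothness of a curve is expressed to
    the recursive [nderivable_on]. *)
Lemma mx_nderivable_of_derive1n n p q (A : R -> 'M[R]_(p, q)) :
  (forall k s, U s -> derivable (derive1n k A) s 1) -> mx_nderivable n A.
Proof.
elim: n A => // n IH A HA i j.
have dA s : U s -> derivable A s 1 by exact: (HA 0%N).
split=> [s Us|]; first by have /derivable_mxP := dA s Us; exact.
have HA' k s : U s -> derivable (derive1n k (derive1 A)) s 1.
  by rewrite -derive1Sn; exact: HA.
apply: nderivable_ext (IH _ HA' i j) => s Us.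
exact/derive1_mxE/dA.
Qed.

Lemma mx_nderivable_derivable n p q (A : R -> 'M[R]_(p, q)) s :
  mx_nderivable n.+1 A -> U s -> derivable A s 1.
Proof. by move=> HA Us; apply/derivable_mxP => i j; exact: (HA i j).1. Qed.

Lemma mx_nderivable_derive1 n p q (A : R -> 'M[R]_(p, q)) :
  mx_nderivable n.+1 A -> mx_nderivable n (derive1 A).
Proof.
move=> HA i j; apply: nderivable_ext (HA i j).2 => s Us.
by rewrite derive1_mxE//; exact: mx_nderivable_derivable HA Us.
Qed.

(** By the chain rule, the derivative is a sum of products of partial derivatives
    of [f] along [x], one class lower, and of derivatives of [x]. *)
Lemma nderivable_comp n m (W : set 'rV[R]_m) (f : 'rV[R]_m -> R)
    (x : R -> 'rV[R]_m) :
  open W -> (forall s, U s -> W (x s)) ->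
  Ck_on n W f -> mx_nderivable n x -> nderivable_on n U (f \o x).
Proof.
move=> oW xW; elim: n f => // n IH f fC xn.
have CR s (Us : U s) := chain_rule oW (Ck_on_ge1 fC) (xW s Us)
  (mx_nderivable_derivable xn Us).
split=> [s /CR[]//|].
have xn' : mx_nderivable n x by move=> i j; exact/nderivable_pred.
have xd := mx_nderivable_derive1 xn.
have : nderivable_on n U
    (fun s => \sum_(i < m) ('D_('e_i) f \o x) s * derive1 x s 0 i).
  apply: nderivable_sum => i; apply: nderivableM; last exact: xd.
  by apply: IH => //; exact: (fC.2 i).2.
by apply: nderivable_ext => s Us; have [_ <-] := CR s Us; rewrite derive1E.
Qed.

End nderivable_theory.

(** * Derivatives of matrix products *)

Lemma is_derive_mulmx (R : realType) p q r (A : R -> 'M[R]_(p, q))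
    (B : R -> 'M[R]_(q, r)) s (dA : 'M[R]_(p, q)) (dB : 'M[R]_(q, r)) :
  is_derive s (1 : R) A dA -> is_derive s (1 : R) B dB ->
  is_derive s (1 : R) (fun t => A t *m B t) (dA *m B s + A s *m dB).
Proof.
move=> [Ad <-] [Bd <-].
have E i j : is_derive s (1 : R) (fun t => (A t *m B t) i j)
    (('D_1 A s *m B s + A s *m 'D_1 B s) i j).
  have -> : (fun t => (A t *m B t) i j) =
      \sum_(k < q) ((fun t => A t i k) * (fun t => B t k j)).
    by apply/funext => t; rewrite mxE fct_sumE.
  have Aik k : derivable (fun t => A t i k) s 1.
    by have /derivable_mxP := Ad; exact.
  have Bkj k : derivable (fun t => B t k j) s 1.
    by have /derivable_mxP := Bd; exact.
  have H k := is_deriveM (derivableP (Aik k)) (derivableP (Bkj k)).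
  apply: is_derive_eq.
  rewrite !mxE -big_split/=; apply: eq_bigr => k _.
  by rewrite !derive_mx// !mxE addrC; congr (_ + _); rewrite [LHS]mulrC.
have d : derivable (fun t => A t *m B t) s 1.
  by apply/derivable_mxP => i j; have [] := E i j.
apply: DeriveDef => //; rewrite derive_mx//.
by apply/matrixP => i j; rewrite mxE; have [_ ->] := E i j.
Qed.

Lemma is_derive_trmx (R : realType) p q (A : R -> 'M[R]_(p, q)) s
    (dA : 'M[R]_(p, q)) :
  is_derive s (1 : R) A dA -> is_derive s (1 : R) (fun t => (A t)^T) dA^T.
Proof.
move=> [Ad <-].
have d : derivable (fun t => (A t)^T) s 1.
  apply/derivable_mxP => i j; under eq_fun do rewrite mxE.
  by have /derivable_mxP := Ad; exact.
apply: DeriveDef => //; rewrite !derive_mx//.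
by apply/matrixP => i j; rewrite !mxE; under eq_fun do rewrite mxE.
Qed.

(** * The Levi-Civita connection along a curve in one chart *)

Section InChart.
Context {R : realType} {m : nat} {M : smooth_manifold R m}.
Variables (g : riemannian_metric M) (I : set R) (gamma : R -> M).
Hypotheses (oI : open I) (smooth_gamma : smooth_curve I gamma).
Variable c : chart R m M.
Hypothesis hc : atlas c.

Let U : set R := [set s | I s /\ chart_dom c (gamma s)].
Let x : R -> 'rV[R]_m := c \o gamma.
Let T := derive1 x.
Let G (s : R) : 'M[R]_m := g c (x s).
Let Gam k i j (s : R) := christoffel g c (x s) k i j.

(** Openness is what allows derivatives at a time to be computed from identities
    that hold only while the curve is in the chart. *)
Lemma open_chart_times : open U.
Proof.
rewrite openE => s [Is ds]; rewrite /interior.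
have nI : \forall t \near s, I t by exact: open_nbhs_nbhs.
have nd : \forall t \near s, chart_dom c (gamma t).
  apply: (smooth_gamma.1 s Is).
  by apply: open_nbhs_nbhs; split=> //; exact: open_chart_dom.
by near=> t; split; near: t.
Unshelve. all: by end_near. Qed.
Let oU := open_chart_times.

Lemma chart_img_curve s : U s -> chart_img c (x s).
Proof. by move=> [Is ds]; exists (gamma s). Qed.
Let xW := chart_img_curve.

Lemma curve_nderivable n : mx_nderivable U n x.
Proof.
apply: mx_nderivable_of_derive1n => // k s [Is ds].
exact: (smooth_gamma.2 c s hc Is ds k).
Qed.

Lemma velocity_nderivable n : mx_nderivable U n (velocity gamma c).
Proof. by apply: mx_nderivable_derive1 => //; exact: curve_nderivable. Qed.

Lemma gram_nderivable n : mx_nderivable U n G.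
Proof.
move=> i j.
have H := @nderivable_comp R U oU n m (chart_img c) (fun y => g c y i j) x.
apply: H; [exact: open_chart_img|exact: xW| |exact: curve_nderivable].
by apply: Ck_on_entry; [exact: open_chart_img|exact: gram_smooth].
Qed.

(** One order of differentiability of the Gram matrix is spent, which is why
    smoothness of the metric is used at order [n.+1]. *)
Lemma dgram_nderivable n l i j :
  nderivable_on n U (fun s => dgram g c (x s) l i j).
Proof.
have H := @nderivable_comp R U oU n m (chart_img c)
  (fun y => dgram g c y l i j) x.
apply: H; [exact: open_chart_img|exact: xW| |exact: curve_nderivable].
apply: Ck_on_entry; first exact: open_chart_img.
by have [_ /(_ l)[]] := gram_smooth g hc n.+1.
Qed.

Lemma christoffel_nderivable n k i j : nderivable_on n U (Gam k i j).
Proof.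
apply: nderivableM => //; first exact: nderivable_cst.
apply: nderivable_sum => // l; apply: nderivableM => //.
  apply: (mx_nderivable_inv oU _ (gram_nderivable n)) => s Us.
  exact/gram_unitmx/xW.
apply: nderivableD => //.
  by apply: nderivableD => //; exact: dgram_nderivable.
have := nderivableM oU (nderivable_cst oU n (-1)) (dgram_nderivable n l i j).
apply: nderivable_ext => // s _.
by rewrite mulN1r.
Qed.

Lemma cov_deriv_nderivable n xi :
  mx_nderivable U n.+1 (xi c) -> mx_nderivable U n (cov_deriv g gamma xi c).
Proof.
move=> xin i k; rewrite ord1 {i}.
have H : nderivable_on n U (fun s => \sum_i \sum_j
    Gam k i j s * velocity gamma c s 0 i * xi c s 0 j).
  apply: nderivable_sum => // i; apply: nderivable_sum => // j.
  apply: nderivableM => //; last exact: nderivable_pred (xin 0 j).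
  apply: nderivableM => //; first exact: christoffel_nderivable.
  exact: velocity_nderivable.
have := nderivableD oU (mx_nderivable_derive1 oU xin 0 k) H.
apply: nderivable_ext => // s _.
by rewrite !mxE.
Qed.

(** Row-vector convention: a field [v] is parallel along the curve when
    [v' = - v *m connection_mx]. *)
Definition connection_mx (s : R) : 'M[R]_m :=
  \matrix_(i, k) \sum_l Gam k l i s * T s 0 l.

Lemma cov_derivE xi s :
  cov_deriv g gamma xi c s = derive1 (xi c) s + xi c s *m connection_mx s.
Proof.
congr (_ + _); apply/rowP => k; rewrite !mxE exchange_big/=.
apply: eq_bigr => j _; rewrite !mxE mulr_sumr; apply: eq_bigr => i _.
by rewrite mulrC.
Qed.

(** Metric compatibility of the Christoffel symbols, contracted with the velocity
    through the chain rule. *)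
Lemma is_derive_gram s : U s ->
  is_derive s (1 : R) G (connection_mx s *m G s + G s *m (connection_mx s)^T).
Proof.
move=> Us; have dG := mx_nderivable_derivable (gram_nderivable 1) Us.
have dx := mx_nderivable_derivable (curve_nderivable 1) Us.
apply: DeriveDef => //; rewrite derive_mx//; apply/matrixP => i j; rewrite mxE.
have GC : Ck_on 1 (chart_img c) (fun y => g c y i j).
  by apply: Ck_on_entry; [exact: open_chart_img|exact: gram_smooth].
have [_ ->] := chain_rule (@open_chart_img _ _ _ c) GC (xW Us) dx.
have [_ compat] : torsion_free (fun k i j => Gam k i j s) /\
    metric_compatible g c (x s) (fun k i j => Gam k i j s).
  exact: (levi_civitaP g (fun k i j => Gam k i j s) hc (xW Us)).2.
have entryE l : 'D_('e_l) (fun y => g c y i j) (x s) = dgram g c (x s) l i j.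
  by rewrite /dgram (derive_mx (@derivable_gram _ _ _ g _ _ l hc (xW Us))) mxE.
have termE l : 'D_('e_l) (fun y => g c y i j) (x s) * T s 0 l =
    \sum_k Gam k l i s * T s 0 l * G s k j +
    \sum_k G s i k * (Gam k l j s * T s 0 l).
  rewrite entryE (compat l i j) mulrDl !mulr_suml; congr (_ + _).
    by apply: eq_bigr => k _; rewrite mulrAC.
  by apply: eq_bigr => k _; rewrite mulrAC mulrC.
rewrite (eq_bigr _ (fun l _ => termE l)) big_split/=.
rewrite [in RHS]mxE [in RHS]mxE [X in _ = _ + X]mxE; congr (_ + _).
  rewrite exchange_big/=; apply: eq_bigr => k _.
  by rewrite [in RHS]mxE mulr_suml.
rewrite exchange_big/=; apply: eq_bigr => k _.
by rewrite [in RHS]mxE [in RHS]mxE mulr_sumr.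
Qed.

Let ip (xi eta : field_along) (s : R) := ginner g c (x s) (xi c s) (eta c s).

(** Differentiating [u G v^T] and substituting [G' = C G + G C^T], each connection
    term joins the ordinary derivative of the neighbouring field to form its
    covariant derivative. *)
Lemma is_derive_ginner xi eta s : U s ->
  derivable (xi c) s 1 -> derivable (eta c) s 1 ->
  is_derive s (1 : R) (ip xi eta)
    (ip (cov_deriv g gamma xi) eta s + ip xi (cov_deriv g gamma eta) s).
Proof.
move=> Us dxi deta.
have H := is_derive_mulmx (is_derive_mulmx (derivableP dxi) (is_derive_gram Us))
  (is_derive_trmx (derivableP deta)).
have [dH eH] := H.
rewrite -[ip xi eta]/(fun t => (xi c t *m G t *m (eta c t)^T) 0 0).
apply: DeriveDef; first by have /derivable_mxP := dH; exact.
rewrite -derive1E -derive1_mxE// derive1E eH.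
rewrite /ip /ginner -/(G s) !cov_derivE !derive1E.
set a := xi c s; set b := eta c s; set da := 'D_1 (xi c) s.
set db := 'D_1 (eta c) s; set C := connection_mx s.
have -> : (da *m G s + a *m (C *m G s + G s *m C^T)) *m b^T +
      a *m G s *m db^T =
    (da + a *m C) *m G s *m b^T + a *m G s *m (db + b *m C)^T.
  have -> : (db + b *m C)^T = db^T + C^T *m b^T.
    by rewrite [LHS]linearD/= trmx_mul.
  rewrite !mulmxDl !mulmxDr !mulmxDl !mulmxA -!addrA.
  by do 2 congr (_ + _); rewrite addrC.
by rewrite [LHS]mxE.
Qed.

Lemma ginner_sym xi eta s : U s -> ip xi eta s = ip eta xi s.
Proof.
move=> Us; rewrite /ip /ginner.
have <- : (xi c s *m G s *m (eta c s)^T)^T = eta c s *m G s *m (xi c s)^T.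
  by rewrite !trmx_mul trmxK mulmxA gram_sym//; exact: xW.
by rewrite [RHS]mxE.
Qed.

Lemma ginner_eq0 xi s : U s -> ip xi xi s = 0 -> xi c s = 0.
Proof.
move=> Us xi0; apply/eqP; apply: contraT => /(gram_pos g hc (xW Us)).
by rewrite -/(ginner g c (x s) (xi c s) (xi c s)) -/(ip xi xi s) xi0 ltxx.
Qed.

End InChart.

(** * From vanishing third derivative to geodesics *)

(** Vanishing at all times in the chart, rather than at one time, is what makes the
    ordinary derivative of the components vanish too. *)
Lemma cov_deriv_vanishes (R : realType) m (M : smooth_manifold R m)
    (g : riemannian_metric M) (I : set R) (gamma : R -> M) xi :
  open I -> smooth_curve I gamma -> vanishes_along I gamma xi ->
  vanishes_along I gamma (cov_deriv g gamma xi).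
Proof.
move=> oI sg xi0 c s hc Is ds.
have oU := open_chart_times oI sg (c := c).
rewrite cov_derivE xi0// mul0mx addr0.
rewrite (eq_derive1_on (h := fun=> 0) oU (conj Is ds)); first exact: derive1_cst.
by move=> t [It dt]; exact: xi0.
Qed.

(** The successive derivatives of [<T0, T0> = 1], with [T3 = 0], force first [T2]
    and then [T1] to be null for the metric. *)
Lemma H_tensional_geodesic (R : realType) m (M : smooth_manifold R m)
    (g : riemannian_metric M) (I : set R) (gamma : R -> M) :
  open I -> smooth_curve I gamma -> unit_speed g I gamma ->
  H_tensional g I gamma -> geodesic g I gamma.
Proof.
move=> oI sg us Ht c s0 hc Is0 ds0.
pose U : set R := [set s | I s /\ chart_dom c (gamma s)].
have oU : open U := open_chart_times oI sg (c := c).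
pose D := cov_deriv g gamma.
pose T0 : field_along (M := M) := velocity gamma.
pose T1 := D T0; pose T2 := D T1.
have dT0 : mx_nderivable U 3 (T0 c) by exact: velocity_nderivable.
have dT1 : mx_nderivable U 2 (T1 c) by exact: cov_deriv_nderivable.
have dT2 : mx_nderivable U 1 (T2 c) by exact: cov_deriv_nderivable.
pose ip (xi eta : field_along (M := M)) (s : R) :=
  ginner g c (c (gamma s)) (xi c s) (eta c s).
have T3_eq0 s : U s -> D T2 c s = 0.
  by move=> [Is ds]; apply/eqP; rewrite -oppr_eq0; apply/eqP; exact: Ht.
have ip0l xi eta s : xi c s = 0 -> ip xi eta s = 0.
  by move=> xi0; rewrite /ip /ginner xi0 !mul0mx mxE.
have leibniz n k xi eta s : U s ->
    mx_nderivable U n.+1 (xi c) -> mx_nderivable U k.+1 (eta c) ->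
    is_derive s (1 : R) (ip xi eta) (ip (D xi) eta s + ip xi (D eta) s).
  move=> Us dxi deta.
  exact: (is_derive_ginner g oI sg hc Us (mx_nderivable_derivable dxi Us)
    (mx_nderivable_derivable deta Us)).
have ipC xi eta s : U s -> ip xi eta s = ip eta xi s.
  exact: (ginner_sym g hc).
have const_on (f : R -> R) a df s : (forall t, U t -> f t = a) -> U s ->
    is_derive s (1 : R) f df -> df = 0.
  move=> fa Us [_ <-]; rewrite -derive1E.
  by rewrite (eq_derive1_on (h := fun=> a) oU Us fa) derive1_cst.
have T00 s : U s -> ip T0 T0 s = 1.
  move=> [Is ds].
  have e : Num.sqrt (ip T0 T0 s) = 1 by exact: us.
  have p0 : 0 <= ip T0 T0 s by rewrite ltW// -sqrtr_gt0 e.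
  by rewrite -(sqr_sqrtr p0) e expr1n.
have T10 s : U s -> ip T1 T0 s = 0.
  move=> Us; have := const_on _ _ _ _ T00 Us (leibniz _ _ _ _ _ Us dT0 dT0).
  rewrite [X in _ + X](ipC _ _ _ Us) -mulr2n.
  by move/eqP; rewrite mulrn_eq0 => /eqP.
have T20 s : U s -> ip T2 T0 s + ip T1 T1 s = 0.
  by move=> Us; apply: const_on T10 Us (leibniz _ _ _ _ _ Us dT1 dT0).
have T21 s : U s -> ip T2 T1 s = 0.
  move=> Us; have := const_on _ _ _ _ T20 Us
    (is_deriveD (leibniz _ _ _ _ _ Us dT2 dT0) (leibniz _ _ _ _ _ Us dT1 dT1)).
  rewrite (ip0l (D T2))//; last exact: T3_eq0.
  rewrite [ip T1 (D T1) s](ipC _ _ _ Us) add0r -mulr2n -mulrS.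
  by move/eqP; rewrite mulrn_eq0 => /eqP.
have T22 s : U s -> T2 c s = 0.
  move=> Us; apply: (ginner_eq0 (xi := T2) hc Us).
  have := const_on _ _ _ _ T21 Us (leibniz _ _ _ _ _ Us dT2 dT1).
  by rewrite (ip0l (D T2)) ?add0r; [exact|exact: T3_eq0].
have Us0 : U s0 by [].
apply: (ginner_eq0 (xi := T1) hc Us0).
by have := T20 s0 Us0; rewrite (ip0l T2) ?add0r; [exact|exact: T22].
Qed.

Theorem theorem5p10 (R : realType) (m : nat) (M : smooth_manifold R m)
    (g : riemannian_metric M) (I : set R) (gamma : R -> M) :
  open I -> is_interval I ->
  regular_curve I gamma -> unit_speed g I gamma ->
  (H_tensional g I gamma <-> geodesic g I gamma).
Proof.
move=> oI _ [sg _] us; split; first exact: H_tensional_geodesic.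
move=> geo c s hc Is ds; rewrite /rough_laplacian.
have T2 := cov_deriv_vanishes g oI sg geo.
by rewrite (cov_deriv_vanishes g oI sg T2)// oppr0.
Qed.
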